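(* For every integer $d\ge 2$ and every measurable zero-sum-free set $A\subseteq \mathbb S^{d-1}$, one has $$\sigma_{d-1}(A)\le \frac{\lfloor (d+1)^2/2\rfloor}{d(d+1)}.$$
   Context: $\mathbb S^{d-1}$ is the unit sphere in $\mathbb R^d$, and $\sigma_{d-1}$ is its rotation-invariant (surface) probability measure. A measurable set $A\subseteq\mathbb S^{d-1}$ is called zero-sum-free if there are no $x,y,z\in A$ with $x+y+z=0$ (sum in $\mathbb R^d$). *)

(* Defs.v *)
From HB Require Import structures.
From mathcomp Require Import all_boot all_order all_algebra.
From mathcomp Require Import all_classical all_reals all_analysis.
Import Order.TTheory GRing.Theory Num.Theory.
Import numFieldNormedType.Exports.

Set Implicit Arguments.
Unset Strict Implicit.
Unset Printing Implicit Defensive.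

Local Open Scope classical_set_scope.
Local Open Scope ring_scope.

(* The topology on ['rV[R]_d] is the one of the sup norm, i.e., the usual
   topology of R^d, so this is R^d with its Borel sigma-algebra. *)
Notation borelRn R d := (g_sigma_algebraType (@open 'rV[R]_d)).

(* The library norm [`|x|] on row vectors is the sup norm, hence an explicit
   Euclidean norm. *)
Definition enorm (R : realType) (d : nat) (x : 'rV[R]_d) : R :=
  Num.sqrt (\sum_(i < d) x 0 i ^+ 2).

Definition unit_sphere (R : realType) (d : nat) : set 'rV[R]_d :=
  [set x | enorm x = 1].

Definition rotation (R : realType) (d : nat) (g : 'M[R]_d) : Prop :=
  g *m g^T = 1%:M /\ \det g = 1.

(* The surface probability measure on the sphere, seen as a Borel probability
   measure on R^d that is concentrated on the sphere. For [2 <= d] there is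
   exactly one such [sigma]. *)
Definition uniform_on_sphere (R : realType) (d : nat)
    (sigma : probability (borelRn R d) R) : Prop :=
  sigma (@unit_sphere R d) = 1%E /\
  forall (g : 'M[R]_d) (B : set (borelRn R d)), rotation g -> measurable B ->
    sigma ((fun x : 'rV[R]_d => x *m g) @^-1` B) = sigma B.

(* The completion of [sigma]: its measurable sets are the sets that are
   Caratheodory-measurable for the outer measure [sigma^*]. They include all
   Borel sets, on which the completion agrees with [sigma]. *)
Definition completed_measurable (R : realType) (d : nat)
    (sigma : probability (borelRn R d) R) (A : set 'rV[R]_d) : Prop :=
  (sigma^*)%mu.-cara.-measurable A.

Definition completed (R : realType) (d : nat)
    (sigma : probability (borelRn R d) R) (A : set 'rV[R]_d) : \bar R :=
  @completed_measure_extension _ (borelRn R d) R sigma A.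

Definition zero_sum_free (R : realType) (d : nat) (A : set 'rV[R]_d) : Prop :=
  ~ exists x y z : 'rV[R]_d, [/\ A x, A y, A z & x + y + z = 0].

(* Main.v *)
(** If [v_0, ..., v_d] are the vertices of a regular simplex, the unit vectors
    [r_ij] parallel to [v_i - v_j], [i <> j], satisfy [r_ij + r_jk + r_ki = 0].
    So for every rotation [g] the pairs [(i, j)] with [r_ij g] in a
    zero-sum-free set are the arcs of a digraph on [d + 1] vertices without
    directed triangles, and there are at most [(d + 1)^2 / 2] of them. The bound
    is the average of this inequality over a random [g] for which every [r_ij g]
    is uniformly distributed. In place of the Haar measure, [g] is obtained by
    applying the Gram-Schmidt process to independent uniform points of the
    sphere, restricted to an event of positive probability on which they are
    linearly independent. *)

Require Import Defs.
From mathcomp Require Import all_boot all_order all_algebra.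
From mathcomp Require Import all_classical all_reals all_analysis.
From mathcomp Require Import measurable_realfun ring lra zify.
Import Order.TTheory GRing.Theory Num.Theory.
Import numFieldNormedType.Exports.

Set Implicit Arguments.
Unset Strict Implicit.
Unset Printing Implicit Defensive.

Local Open Scope classical_set_scope.
Local Open Scope ring_scope.

(** * Digraphs without directed triangles, reflections, simplices *)

(* Induction on [V]: if [e u v] and [e v u], then each other vertex is joined to
   [u] and [v] by at most two arcs, so removing [u] and [v] is enough. Without
   such a pair, there are at most [#|V| (#|V| - 1) / 2] arcs. *)
Lemma sum_arcs_triangle_free (T : finType) (e : rel T) (V : {set T}) :
  irreflexive e -> (forall x y z, e x y -> e y z -> ~~ e z x) ->
  (2 * \sum_(i in V) \sum_(j in V) e i j <= #|V| ^ 2)%N.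
Proof.
move=> e_irr e_free.
pose S (W : {set T}) := (\sum_(i in W) \sum_(j in W) e i j)%N.
have SD1 (W : {set T}) u : u \in W ->
    S W = (S (W :\ u) + \sum_(j in W :\ u) (e u j + e j u))%N.
  move=> uW; rewrite /S (big_setD1 u)//= (big_setD1 u)//= e_irr add0n.
  under [in X in (_ + X)%N]eq_bigr do rewrite (big_setD1 u)//=.
  by rewrite !big_split/=; lia.
have [n] := ubnP #|V|; rewrite -/(S V).
elim: n V => // n IH V /ltnSE-leV.
have [/existsP[u /existsP[v /and5P[uv uV vV euv evu]]]|] :=
  boolP [exists u, exists v, [&& u != v, u \in V, v \in V, e u v & e v u]].
- pose W := V :\ u :\ v.
  have vVu : v \in V :\ u by rewrite !inE eq_sym uv.
  have cV : #|V| = #|W|.+2 by rewrite (cardsD1 u V) uV (cardsD1 v (V :\ u)) vVu.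
  rewrite (SD1 V u)// (SD1 (V :\ u) v)// (big_setD1 v vVu)/= -/W.
  have : (\sum_(j in W) (e v j + e j v) + \sum_(j in W) (e u j + e j u)
          <= #|W| * 2)%N.
    rewrite -big_split/= -sum_nat_const; apply: leq_sum => j _.
    (* The arcs [v j] and [j u] would close a triangle with [u v], and [u j] and [j v] one with
       [v u]; so each of these two pairs contributes at most one arc. *)
    have := e_free _ _ j euv; have := e_free _ _ j evu.
    case: (e v j); case: (e j v); case: (e u j); case: (e j u) => //= A B;
      by [have := A isT | have := B isT].
  have WIH : (2 * S W <= #|W| ^ 2)%N by apply: IH; lia.
  (* Two arcs join [u] and [v], at most [2 #|W|] others meet them, and
     [#|W| ^ 2 + 4 #|W| + 4 = (#|W| + 2) ^ 2]. *)
  by move: WIH; rewrite cV euv evu -!mulnn; nia.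
(* Adding the sum to its transpose leaves [e i j + e j i <= 1] to check for each ordered pair. *)
- rewrite negb_exists => /forallP no2; rewrite mul2n -addnn {1}/S exchange_big/=.
  rewrite -big_split/= -mulnn -sum_nat_const; apply: leq_sum => i iV.
  rewrite -big_split/= -[leqRHS]muln1 -sum_nat_const; apply: leq_sum => j jV.
  have := no2 i; rewrite negb_exists => /forallP/(_ j); rewrite iV jV/=.
  have [->|] := eqVneq i j; first by rewrite e_irr.
  by case: (e i j); case: (e j i).
Qed.

Lemma unit_sphereP (R : realType) d (x : 'rV[R]_d) :
  unit_sphere x <-> x *m x^T = 1%:M.
Proof.
have E : (x *m x^T) 0 0 = \sum_(i < d) x 0 i ^+ 2.
  by rewrite mxE; apply: eq_bigr => i _; rewrite mxE expr2.
have ge0 : 0 <= \sum_(i < d) x 0 i ^+ 2 by apply: sumr_ge0 => i _; exact: sqr_ge0.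
rewrite /unit_sphere/= /enorm; split => [|xx].
  move=> /(congr1 (fun y => y ^+ 2)); rewrite expr1n sqr_sqrtr// => h.
  by rewrite [LHS]mx11_scalar E h.
by rewrite -E xx mxE eqxx sqrtr1.
Qed.

(** * Reflections and the transitivity of rotations on the sphere *)

Section Reflections.
Context {R : realType}.

Lemma dot_gt0 d (w : 'rV[R]_d) : w != 0 -> 0 < (w *m w^T) 0 0.
Proof.
move=> /eqP w0; rewrite mxE lt_def sumr_ge0 ?andbT; last first.
  by move=> i _; rewrite mxE -expr2 sqr_ge0.
apply/negP => /eqP/psumr_eq0P h; apply: w0; apply/rowP => i; rewrite mxE.
have : w 0 i * w^T i 0 = 0 by apply: h => // j _; rewrite mxE -expr2 sqr_ge0.
by rewrite mxE -expr2 => /eqP; rewrite sqrf_eq0 => /eqP.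
Qed.

(** Both sides are the determinant of the block matrix with rows [1, v] and [u, 1], computed by
    clearing [u] in [E1] and [v] in [E2]. *)
Lemma det_1_sub_rank1 (d : nat) (u : 'cV[R]_d) (v : 'rV[R]_d) :
  \det (1%:M - u *m v) = 1 - (v *m u) 0 0.
Proof.
have E1 : block_mx 1%:M (0 : 'M[R]_(1, d)) (- u) 1%:M *m block_mx 1%:M v u 1%:M =
          block_mx (1%:M : 'M[R]_1) v 0 (1%:M - u *m v).
  rewrite mulmx_block !mul1mx !mul0mx !addr0 !mulmx1 mulNmx.
  by rewrite addNr [X in block_mx _ _ _ X]addrC.
have E2 : block_mx 1%:M (- v) (0 : 'M[R]_(d, 1)) 1%:M *m block_mx 1%:M v u 1%:M =
          block_mx (1%:M - v *m u : 'M[R]_1) 0 u 1%:M.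
  rewrite mulmx_block !mul1mx !mul0mx !add0r !mulmx1 mulNmx.
  by rewrite addrN.
have := congr1 determinant E1; rewrite det_mulmx det_lblock !det1 !mul1r det_ublock.
rewrite det1 mul1r => <-.
have := congr1 determinant E2; rewrite det_mulmx det_ublock !det1 !mul1r det_lblock.
by rewrite det1 mulr1 => ->; rewrite det_mx11 !mxE.
Qed.

Definition householder d (w : 'rV[R]_d) : 'M[R]_d :=
  1%:M - (2 / (w *m w^T) 0 0) *: (w^T *m w).

Lemma householderM d (x w : 'rV[R]_d) :
  x *m householder w = x - (2 * (x *m w^T) 0 0 / (w *m w^T) 0 0) *: w.
Proof.
rewrite /householder mulmxBr mulmx1 -scalemxAr mulmxA.
have -> : x *m w^T *m w = (x *m w^T) 0 0 *: w.
  by rewrite {1}[x *m w^T]mx11_scalar mul_scalar_mx.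
by rewrite scalerA mulrAC.
Qed.

Lemma householder_orth d (w : 'rV[R]_d) : w != 0 ->
  householder w *m (householder w)^T = 1%:M.
Proof.
move=> w0; have c0 := lt0r_neq0 (dot_gt0 w0).
have -> : (householder w)^T = householder w.
  by rewrite /householder linearB/= linearZ/= trmx1 trmx_mul trmxK.
rewrite {2}/householder mulmxBr mulmx1 -scalemxAr mulmxA.
have -> : householder w *m w^T = - w^T.
  rewrite /householder mulmxBl mul1mx -scalemxAl -mulmxA.
  rewrite {2}[w *m w^T]mx11_scalar mul_mx_scalar scalerA divfK//.
  by rewrite scaler_nat mulr2n opprD addrA addrN add0r.
rewrite mulNmx scalerN opprK /householder -addrA [X in _ + X]addNr addr0//.
Qed.

Lemma det_householder d (w : 'rV[R]_d) : w != 0 -> \det (householder w) = -1.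
Proof.
move=> w0; have c0 := lt0r_neq0 (dot_gt0 w0).
rewrite /householder scalemxAl det_1_sub_rank1 -scalemxAr mxE divfK//.
by ring.
Qed.

Lemma orth_neq0 k d (U : 'M[R]_(k, d)) : (k < d)%N ->
  exists2 z : 'rV[R]_d, z != 0 & U *m z^T = 0.
Proof.
move=> kd; have : kermx U^T != 0.
  rewrite kermx_eq0 /row_free ltn_eqF// mxrank_tr.
  by rewrite (leq_ltn_trans (rank_leq_row _)).
case/rowV0Pn => z /sub_kermxP zU z0; exists z => //.
by rewrite -[LHS]trmxK trmx_mul trmxK zU trmx0.
Qed.

(** The reflection along [x - y] sends [x] to [y] but has determinant [-1]. A second reflection,
    along some [z] orthogonal to [y], fixes [y] and restores the determinant; [1 < d] provides
    [z]. *)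
Lemma rotation_transitive d (x y : 'rV[R]_d) : (1 < d)%N ->
  unit_sphere x -> unit_sphere y -> exists2 g, rotation g & x *m g = y.
Proof.
move=> d1 /unit_sphereP xx /unit_sphereP yy.
have [<-|nxy] := eqVneq x y.
  by exists 1%:M; rewrite ?mulmx1//; split; rewrite ?det1// mul1mx trmx1.
have [z z0 yz] := orth_neq0 y d1.
have w0 : x - y != 0 by rewrite subr_eq0.
exists (householder (x - y) *m householder z).
  split; last by rewrite det_mulmx !det_householder// mulrNN mulr1.
  rewrite trmx_mul mulmxA -(mulmxA _ (householder z)) householder_orth//.
  by rewrite mulmx1 householder_orth.
have c : (y *m x^T) 0 0 = (x *m y^T) 0 0.
  by rewrite -[y *m x^T]trmxK trmx_mul trmxK mxE.
have mB (a b : 'M[R]_1) : (a - b) 0 0 = a 0 0 - b 0 0 by rewrite !mxE.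
have m1 : (1%:M : 'M[R]_1) 0 0 = 1 by rewrite mxE eqxx.
have E1 : (x *m (x - y)^T) 0 0 = 1 - (x *m y^T) 0 0.
  by rewrite linearB/= mulmxBr xx mB m1.
have E2 : ((x - y) *m (x - y)^T) 0 0 = 2 * (1 - (x *m y^T) 0 0).
  by rewrite mulmxBl mB E1 linearB/= mulmxBr yy mB m1 c; ring.
have xye : x *m householder (x - y) = y.
  have := lt0r_neq0 (dot_gt0 w0); rewrite householderM E1 E2 => h.
  by rewrite divff// scale1r opprB addrC subrK.
by rewrite mulmxA xye householderM yz mxE mulr0 mul0r scale0r subr0.
Qed.

End Reflections.

(* The edge directions of a regular simplex, i.e., the root system [A_d]. The
   vertices are the basis vectors and a multiple of the all-ones vector. *)
Lemma simplex_edges (R : realType) d : (0 < d)%N ->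
  exists r : 'I_d.+1 -> 'I_d.+1 -> 'rV[R]_d,
    (forall i j, i != j -> unit_sphere (r i j)) /\
    (forall i j k, r i j + r j k + r k i = 0).
Proof.
move=> d0; have dn0 : d%:R != 0 :> R by rewrite pnatr_eq0 -lt0n.
pose s : R := Num.sqrt (1 + d%:R).
have ss : s ^+ 2 = 1 + d%:R by rewrite sqr_sqrtr// addr_ge0.
(* A root of [d c ^ 2 - 2 c = 1]. It puts [const_mx c] at squared distance [d c ^ 2 - 2 c + 1 = 2]
   from every basis vector, which is also the squared distance between two basis vectors. *)
pose c := (1 + s) / d%:R.
have ce : d%:R * c ^+ 2 - 2 * c = 1.
  transitivity (((1 + s) ^+ 2 - 2 * (1 + s)) / d%:R); first by rewrite /c; field.
  by rewrite sqrrD ss expr1n; field.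
pose v (i : 'I_d.+1) : 'rV[R]_d :=
  if unlift ord0 i is Some j then delta_mx 0 j else const_mx c.
have dist2 i j : i != j -> \sum_k (v i - v j) 0 k ^+ 2 = 2.
  have e2 k l : \sum_m (delta_mx 0 k - delta_mx 0 l : 'rV[R]_d) 0 m ^+ 2 =
      2 * (k != l)%:R.
    have [->|kl] := eqVneq k l.
      by rewrite mulr0 big1// => m _; rewrite !mxE subrr expr0n.
    rewrite (bigD1 k)//= (bigD1 l) 1?eq_sym//= big1 => [|m /andP[mk ml]].
      by rewrite !mxE !eqxx/= (negPf kl) eq_sym (negPf kl) ?mulr0n; ring.
    by rewrite !mxE !eqxx/= (negPf mk) (negPf ml) ?mulr0n; ring.
  have ec k : \sum_m (delta_mx 0 k - const_mx c : 'rV[R]_d) 0 m ^+ 2 = 2.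
    under eq_bigr => m _.
      rewrite (_ : _ ^+ 2 = c ^+ 2 + (1 - 2 * c) * (m == k)%:R); last first.
        by rewrite !mxE eqxx/=; case: (m == k); rewrite ?mulr0n ?mulr1n; ring.
      over.
    rewrite big_split/= sumr_const card_ord -mulr_sumr.
    rewrite (bigD1 k)//= eqxx big1 ?addr0 => [|m /negPf->//].
    by rewrite -(mulr_natl (c ^+ 2)) mulr1n; move: ce; lra.
  rewrite /v; case: unliftP => [k|] ->; case: unliftP => [l|] ->.
  - by rewrite e2 (inj_eq lift_inj) => ->; rewrite mulr1.
  - by rewrite ec.
  - move=> _; rewrite -[RHS](ec l); apply: eq_bigr => m _.
    by rewrite !mxE -sqrrN opprB.
  - by rewrite eqxx.
exists (fun i j => (Num.sqrt 2)^-1 *: (v i - v j)); split => [i j /dist2 dij|i j k].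
  rewrite /unit_sphere/= /enorm.
  under eq_bigr do rewrite mxE exprMn.
  by rewrite -mulr_sumr dij exprVn sqr_sqrtr// mulVf ?sqrtr1// pnatr_eq0.
by rewrite -!scalerDr !subrKA subrr scaler0.
Qed.

Lemma zero_sum_free_edges (R : realType) d (A : set 'rV[R]_d) n
    (r : 'I_n -> 'I_n -> 'rV[R]_d) (g : 'M[R]_d) : zero_sum_free A ->
  (forall i j k, r i j + r j k + r k i = 0) ->
  (2 * \sum_i \sum_j (i != j) && `[< A (r i j *m g) >] <= n ^ 2)%N.
Proof.
move=> A0 r0.
have := @sum_arcs_triangle_free _
  [rel i j | (i != j) && `[< A (r i j *m g) >]] [set: 'I_n]%SET.
have sumT (F : 'I_n -> nat) : (\sum_(i in [set: 'I_n]%SET) F i = \sum_i F i)%N.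
  by apply: eq_bigl => i; rewrite inE.
rewrite cardsT card_ord sumT; under eq_bigr do rewrite sumT; apply => /=.
- by move=> i; rewrite /= eqxx.
- move=> i j k /= /andP[_ /asboolP ij] /andP[_ /asboolP jk].
  rewrite negb_and; apply/orP; right; apply/negP => /asboolP ki; apply: A0.
  exists (r i j *m g), (r j k *m g), (r k i *m g); split => //.
  by rewrite -!mulmxDl r0 mul0mx.
Qed.

(** * Borel sets of row vectors *)

Section BorelRows.
Context {R : realType} {d : nat}.

Lemma measurable_coord (j : 'I_d) :
  measurable_fun [set: borelRn R d] (fun x : borelRn R d => (x : 'rV[R]_d) 0 j).
Proof.
apply: (measurability _ (RGenOpens.measurableE R)) => _ [_ [a [b ->] <-]].
rewrite setTI; apply: sub_sigma_algebra => /=.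
apply: (@open_comp _ _ (fun x : 'rV[R]_d => x 0 j)); last exact: interval_open.
by move=> x _; exact: coord_continuous.
Qed.

Definition rat_box (p : 'rV[rat]_d * nat) : set 'rV[R]_d :=
  [set x | forall j, `|x 0 j - ratr (p.1 0 j)| < p.2.+1%:R^-1].

(** The union is countable, so measurability of a map into [borelRn R d] can be tested on boxes,
    hence on coordinates. *)
Lemma open_bigcup_rat_box (U : set 'rV[R]_d) : open U ->
  U = \bigcup_(p : 'rV[rat]_d * nat)
    (if `[< rat_box p `<=` U >] then rat_box p else set0).
Proof.
move=> oU; apply/seteqP; split => [x Ux|x [p _]]; last first.
  by case: ifPn => // /asboolP; apply.
have : nbhs x U by exact: open_nbhs_nbhs.
move=> /nbhs_ballP[e /= e0 xeU].
(* Two points of a box of radius [n.+1%:R^-1] differ by less than [e] in each coordinate, so a box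
   of this radius containing [x] lies in the sup-norm ball. *)
have [n ne] : exists n, n.+1%:R^-1 < e / 2.
  have e2 : 0 < (e / 2)^-1 by rewrite invr_gt0 divr_gt0.
  exists (Num.trunc (e / 2)^-1).
  by rewrite -[ltRHS]invrK ltf_pV2 ?posrE// truncnS_gt.
have /choice[q xq] : forall j, exists q : rat, `|x 0 j - ratr q| < n.+1%:R^-1.
  move=> j; have := @rat_in_itvoo R (x 0 j - n.+1%:R^-1) (x 0 j + n.+1%:R^-1).
  rewrite ltrBlDr -addrA ltrDl addr_gt0// => /(_ isT)[q].
  by rewrite in_itv/= => xq; exists q; rewrite distrC ltr_distl.
exists (\row_j q j, n) => //; case: asboolP => [_ j|]; first by rewrite mxE.
case=> y yq; apply: xeU; split => // i j; rewrite (ord1 i) /ball/=.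
have := yq j; have := xq j; rewrite mxE/= => h1 h2.
rewrite (le_lt_trans (ler_distD (ratr (q j)) _ _))// (splitr e) ltrD//.
  exact: lt_trans ne.
by rewrite distrC; exact: lt_trans ne.
Qed.

Lemma measurable_rV dT (T : measurableType dT) (f : T -> 'rV[R]_d) :
  (forall j, measurable_fun [set: T] (fun t => f t 0 j)) ->
  measurable_fun [set: T] (f : T -> borelRn R d).
Proof.
move=> mf.
apply: (@measurability _ _ _ (borelRn R d) _ _ (@open 'rV[R]_d)) => // _ [U oU <-].
rewrite setTI (open_bigcup_rat_box oU) preimage_bigcup.
apply: countable_bigcupT_measurable => [|p]; first exact: countableP.
case: ifPn => _; last by rewrite preimage_set0.
have -> : f @^-1` rat_box p = \bigcap_(j in [set: 'I_d])
    (fun t => f t 0 j) @^-1` [set y | `|y - ratr (p.1 0 j)| < p.2.+1%:R^-1].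
  by apply/seteqP; split => t /= h j //; [move=> _; exact: h|exact: (h j I)].
apply: fin_bigcap_measurable => // j _; rewrite -[X in measurable X]setTI.
apply: mf => //; rewrite [X in measurable X](_ : _ =
  `]ratr (p.1 0 j) - p.2.+1%:R^-1, ratr (p.1 0 j) + p.2.+1%:R^-1[%classic)//.
by apply/seteqP; split => y /=; rewrite in_itv/= ltr_distl.
Qed.

Lemma measurable_mulmx dT (T : measurableType dT) k m (f : T -> 'M[R]_(k, d))
    (g : T -> 'M[R]_(d, m)) :
  (forall i j, measurable_fun [set: T] (fun t => f t i j)) ->
  (forall i j, measurable_fun [set: T] (fun t => g t i j)) ->
  forall i j, measurable_fun [set: T] (fun t => (f t *m g t) i j).
Proof.
move=> mf mg i j; under eq_fun do rewrite mxE.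
by apply: measurable_sum => l; exact: measurable_funM.
Qed.

Lemma measurable_mulmxr (g : 'M[R]_d) : measurable_fun [set: borelRn R d]
  ((fun x : 'rV[R]_d => x *m g) : borelRn R d -> borelRn R d).
Proof.
apply: measurable_rV => j; apply: measurable_mulmx => [i l|i l].
  by rewrite (ord1 i); exact: measurable_coord.
exact: measurable_cst.
Qed.

End BorelRows.

Lemma measurable_eq_cst (R : realType) dT (T : measurableType dT) (f : T -> R)
    (c : R) : measurable_fun [set: T] f -> measurable [set t | f t = c].
Proof.
move=> mf; rewrite -[X in measurable X]setTI.
exact: (mf measurableT [set c] (measurable_set1 c)).
Qed.

(** The maps are applied one coordinate at a time. [\x^] integrates the [m1]-measure of sections,
    which [f1] preserves, and [\x] the [m2]-measure of sections, which [f2] preserves; the two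
    product measures coincide by uniqueness. *)
Lemma preserving_product (R : realType) d1 d2 (T1 : measurableType d1)
    (T2 : measurableType d2) (m1 : probability T1 R) (m2 : probability T2 R)
    (f1 : T1 -> T1) (f2 : T2 -> T2) :
  measurable_fun [set: T1] f1 -> measurable_fun [set: T2] f2 ->
  (forall B, measurable B -> m1 (f1 @^-1` B) = m1 B) ->
  (forall B, measurable B -> m2 (f2 @^-1` B) = m2 B) ->
  forall B, measurable B ->
    (m1 \x^ m2)%E ((fun p => (f1 p.1, f2 p.2)) @^-1` B) = (m1 \x^ m2)%E B.
Proof.
move=> mf1 mf2 pf1 pf2 B mB.
have m12 X : measurable X -> (m1 \x m2)%E X = (m1 \x^ m2)%E X.
  by apply: product_measure_unique => //= *; rewrite product_measure2E.
pose B1 := (fun p : T1 * T2 => (f1 p.1, p.2)) @^-1` B.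
have mB1 : measurable B1.
  rewrite -[B1]setTI; apply: (measurable_fun_pair _ measurable_snd) => //.
  exact: measurableT_comp mf1 measurable_fst.
have mB2 : measurable ((fun p : T1 * T2 => (p.1, f2 p.2)) @^-1` B1).
  rewrite -[X in measurable X]setTI.
  apply: (measurable_fun_pair measurable_fst _) => //.
  exact: measurableT_comp mf2 measurable_snd.
transitivity ((m1 \x^ m2)%E B1); last first.
  apply: eq_integral => t _ /=; rewrite -[RHS]pf1; last exact: measurable_ysection.
  by congr (m1 _); apply/seteqP; split => x; rewrite /= /ysection/= !inE.
rewrite -m12// -[in RHS]m12//; apply: eq_integral => x _ /=.
rewrite -[RHS]pf2; last exact: measurable_xsection.
by congr (m2 _); apply/seteqP; split => t; rewrite /= /xsection/= !inE.
Qed.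

(** * Hyperplanes through the origin *)

Section Hyperplanes.
Context {R : realType} {d : nat} (sigma : probability (borelRn R d) R).
Context (d1 : (1 < d)%N) (hsigma : uniform_on_sphere sigma).

Lemma measurable_dot (a : 'rV[R]_d) :
  measurable_fun [set: borelRn R d] (fun x : 'rV[R]_d => (x *m a^T) 0 0).
Proof.
apply: measurable_mulmx => [i j|i j]; last exact: measurable_cst.
by rewrite (ord1 i); exact: measurable_coord.
Qed.

Lemma rotationT (g : 'M[R]_d) : rotation g -> rotation g^T.
Proof. by move=> [gg g1]; split; rewrite ?det_tr// trmxK; exact: mulmx1C. Qed.

Lemma measurable_unit_sphere :
  measurable (@unit_sphere R d : set (borelRn R d)).
Proof.
rewrite (_ : unit_sphere (d:=d) = [set x : 'rV[R]_d | (x *m x^T) 0 0 = 1]).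
  apply: measurable_eq_cst; apply: measurable_mulmx => i j.
    by rewrite (ord1 i); exact: measurable_coord.
  rewrite (_ : (fun x => _) = fun x : 'rV[R]_d => x 0 i).
    exact: measurable_coord.
  by apply/funext => x; rewrite mxE (ord1 j).
apply/seteqP; split => x /=.
  by move=> /unit_sphereP ->; rewrite mxE.
by move=> xx; apply/unit_sphereP; rewrite [LHS]mx11_scalar xx.
Qed.

Definition hyperplane (a : 'rV[R]_d) : set (borelRn R d) :=
  [set x : 'rV[R]_d | (x *m a^T) 0 0 = 0].

Lemma sigma_hyperplane_unit (a b : 'rV[R]_d) :
  unit_sphere a -> unit_sphere b -> sigma (hyperplane a) = sigma (hyperplane b).
Proof.
move=> ua ub; have [g rg <-] := rotation_transitive d1 ua ub.
rewrite -(hsigma.2 g^T); last 2 first.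
- exact: rotationT.
- exact: measurable_eq_cst (measurable_dot a).
congr (sigma _); apply/seteqP; split => x.
  by rewrite /hyperplane/= trmx_mul mulmxA.
by rewrite /hyperplane/= trmx_mul mulmxA.
Qed.

(* Otherwise, by invariance, all hyperplanes have full measure, hence so does
   the intersection [{0}] of the coordinate hyperplanes. *)
Lemma sigma_hyperplane_lt1 (a : 'rV[R]_d) : a != 0 ->
  (sigma (hyperplane a) < 1)%E.
Proof.
move=> a0; pose s := Num.sqrt ((a *m a^T) 0 0).
have s0 : 0 < s by rewrite sqrtr_gt0 dot_gt0.
have ua : unit_sphere (s^-1 *: a).
  apply/unit_sphereP; rewrite linearZ/= -scalemxAl -scalemxAr scalerA.
  rewrite [a *m a^T]mx11_scalar scale_scalar_mx -[X in _ * X]sqr_sqrtr ?ltW ?dot_gt0//.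
  by rewrite -/s -invfM -expr2 mulVf// lt0r_neq0// exprn_gt0.
have -> : hyperplane a = hyperplane (s^-1 *: a).
  have Z (x : 'rV[R]_d) : (x *m (s^-1 *: a)^T) 0 0 = s^-1 * (x *m a^T) 0 0.
    by rewrite linearZ/= -scalemxAr mxE.
  apply/seteqP; split => x; rewrite /hyperplane/= Z.
    by move=> ->; rewrite mulr0.
  by move=> /eqP; rewrite mulf_eq0 invr_eq0 (gt_eqF s0) => /eqP.
rewrite lt_neqAle probability_le1 ?andbT; last first.
  exact: measurable_eq_cst (measurable_dot _).
apply/negP => /eqP full.
have nul (i : 'I_d) : {ae sigma, forall x, hyperplane (delta_mx 0 i) x}.
  exists (~` hyperplane (delta_mx 0 i)); split => //.
    by apply: measurableC; exact: measurable_eq_cst (measurable_dot _).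
  rewrite probability_setC; last exact: measurable_eq_cst (measurable_dot _).
  rewrite (sigma_hyperplane_unit _ ua) ?full ?subee//.
  apply/unit_sphereP; rewrite trmx_delta mul_delta_mx.
  by apply/matrixP => j k; rewrite !mxE !ord1 !eqxx.
have : {ae sigma, forall x, forall i, hyperplane (delta_mx 0 i) x}.
  exact: filter_forall.
move=> [N [mN N0 sN]].
(* The null set [N] contains every point outside some coordinate hyperplane, hence the sphere, which
   has measure 1. *)
have : (sigma (@unit_sphere R d) <= sigma N)%E.
  apply: le_measure; rewrite ?inE//; first exact: measurable_unit_sphere.
  move=> x xx; apply: sN => /= h.
  have x0 : x = 0 :> 'rV[R]_d.
    apply/rowP => i; have := h i; rewrite /hyperplane/= trmx_delta -colE !mxE.
    by [].
  move: xx => /unit_sphereP; rewrite x0 mul0mx => /matrixP/(_ 0 0).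
  by rewrite !mxE/= => /esym/eqP; rewrite oner_eq0.
by rewrite N0 hsigma.1 lee_fin ler10.
Qed.

End Hyperplanes.

(** * Random rotations *)

Section RandomFrame.
Context {R : realType} {d : nat} (sigma : probability (borelRn R d) R).
Context (d1 : (1 < d)%N) (hsigma : uniform_on_sphere sigma).

(** For orthonormal rows of [U], [U^T *m U] is the orthogonal projection onto their span.
    Normalization is done separately. *)
Definition gram_schmidt k (U : 'M[R]_(k, d)) (x : 'rV[R]_d) : 'rV[R]_d :=
  x - x *m (U^T *m U).

Lemma gram_schmidt_rotation k (U : 'M[R]_(k, d)) x (g : 'M[R]_d) : rotation g ->
  gram_schmidt (U *m g) (x *m g) = gram_schmidt U x *m g.
Proof.
move=> [gg _]; rewrite /gram_schmidt mulmxBl trmx_mul; congr (_ - _).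
by rewrite !mulmxA -(mulmxA x) gg mulmx1.
Qed.

Lemma gram_schmidt_orth k (U : 'M[R]_(k, d)) x : U *m U^T = 1%:M ->
  gram_schmidt U x *m U^T = 0.
Proof.
by move=> UU; rewrite /gram_schmidt mulmxBl -!mulmxA UU mulmx1 subrr.
Qed.

(** The factor is the inverse Euclidean norm, written as a real power so that its measurability
    comes from that of [powR]. *)
Definition normalized (v : 'rV[R]_d) : 'rV[R]_d :=
  (v *m v^T) 0 0 `^ (- 2^-1) *: v.

Lemma normalized_unit v : v != 0 -> normalized v *m (normalized v)^T = 1%:M.
Proof.
move=> v0; have q0 := dot_gt0 v0.
rewrite /normalized linearZ/= -scalemxAl -scalemxAr scalerA -powRD; last first.
  by rewrite (gt_eqF q0)/= implybT.
rewrite -opprD -[2^-1]mul1r -splitr {2}[v *m v^T]mx11_scalar.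
by rewrite scale_scalar_mx powRN powRr1 ?ltW// mulVf// gt_eqF.
Qed.

Lemma normalized_rotation v (g : 'M[R]_d) : rotation g ->
  normalized (v *m g) = normalized v *m g.
Proof.
move=> [gg _]; rewrite /normalized trmx_mul mulmxA -(mulmxA v) gg mulmx1.
by rewrite scalemxAl.
Qed.

(* A [k]-frame depending on a random parameter, such that rotating the frame
   amounts to a measure-preserving change of parameter. It is orthonormal only
   on an event of positive probability, which is all that is needed. *)
Lemma random_frame k : (k <= d)%N ->
  exists (dT : measure_display) (T : measurableType dT) (P : probability T R)
    (U : T -> 'M[R]_(k, d)) (E : set T),
    [/\ forall i j, measurable_fun [set: T] (fun t => U t i j),
        measurable E, (0 < P E)%E, forall t, E t -> U t *m (U t)^T = 1%:M &
        forall g, rotation g -> exists f : T -> T,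
          [/\ measurable_fun [set: T] f,
              forall B, measurable B -> P (f @^-1` B) = P B,
              f @^-1` E = E & forall t, U (f t) = U t *m g]].
Proof.
elim: k => [_|k IH kd].
  exists _, (borelRn R d), sigma, (fun=> 0), setT; split => //.
  - by rewrite [ltRHS]probability_setT lte01.
  - by move=> t _; apply/matrixP => -[].
  - by move=> g _; exists id; split => // t; apply/matrixP => -[].
have [dT [T [P [U [E [mU mE PE UE inv]]]]]] := IH (ltnW kd).
pose v (p : borelRn R d * T) : 'rV[R]_d := gram_schmidt (U p.2) p.1.
pose U' (p : borelRn R d * T) : 'M[R]_(1 + k, d) :=
  col_mx (normalized (v p)) (U p.2).
(* When [E p.2] holds, [v p != 0] says that the fresh point [p.1] lies outside the row span of
   [U p.2]. *)
pose E' := [set p : borelRn R d * T | E p.2 /\ v p != 0].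
have mU2 i j : measurable_fun [set: borelRn R d * T] (fun p => U p.2 i j).
  exact: measurableT_comp (mU i j) measurable_snd.
have mx (j : 'I_d) : measurable_fun [set: borelRn R d * T]
    (fun p : borelRn R d * T => (p.1 : 'rV[R]_d) 0 j).
  exact: measurableT_comp (measurable_coord j) measurable_fst.
have mv i j : measurable_fun [set: borelRn R d * T] (fun p => v p i j).
  rewrite (ord1 i) (_ : (fun p => _) = (fun p : borelRn R d * T =>
    (p.1 : 'rV[R]_d) 0 j - (p.1 *m ((U p.2)^T *m U p.2)) 0 j)); last first.
    by apply/funext => p; rewrite /v /gram_schmidt !mxE.
  apply: measurable_funB => //; apply: measurable_mulmx => [a b|a b].
    by rewrite (ord1 a); exact: mx.
  apply: measurable_mulmx => [{}a l|l c]; last exact: mU2.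
  rewrite (_ : (fun p => _) = (fun p => U p.2 l a)) //.
  by apply/funext => p; rewrite mxE.
have mvv : measurable_fun [set: borelRn R d * T] (fun p => (v p *m (v p)^T) 0 0).
  apply: measurable_mulmx => [//|l c].
  rewrite (_ : (fun p => _) = (fun p => v p c l)) //.
  by apply/funext => p; rewrite mxE.
have v0E p : (v p != 0) = ((v p *m (v p)^T) 0 0 != 0).
  have [->|v0] := eqVneq (v p) 0; first by rewrite mul0mx mxE eqxx.
  by rewrite gt_eqF// dot_gt0.
have mE' : measurable E'.
  rewrite (_ : E' = (@snd (borelRn R d) T) @^-1` E `&`
    ~` [set p | (v p *m (v p)^T) 0 0 = 0]).
    apply: measurableI; last by apply: measurableC; exact: measurable_eq_cst.
    by rewrite -[X in measurable X]setTI; exact: measurable_snd.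
  apply/seteqP; split => p [Ep h]; split => //.
    by apply/eqP; rewrite -v0E.
  by rewrite v0E; exact/eqP.
(* Some nonzero [a] is orthogonal to the [k < d] rows. Points with [v = 0] lie in the row span,
   hence in the hyperplane of [a], whose measure is less than 1. *)
have sE' t : E t -> (0 < sigma (ysection E' t))%E.
  move=> Et; have [a a0 Ua] := @orth_neq0 R _ _ (U t) kd.
  have mY : measurable (ysection E' t) by exact: measurable_ysection.
  rewrite -[ysection _ _]setCK probability_setC; last exact: measurableC.
  rewrite sube_gt0; apply: le_lt_trans (sigma_hyperplane_lt1 d1 hsigma a0).
  apply: le_measure; rewrite ?inE; [exact: measurableC| |].
    exact: measurable_eq_cst (measurable_dot _).
  move=> x; rewrite /ysection/= inE /E'/= => /not_andP[//|/negP/negPn/eqP].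
  rewrite /v/= /gram_schmidt => /eqP; rewrite subr_eq0 => /eqP xU.
  by rewrite /hyperplane/= xU -!mulmxA Ua !mulmx0 mxE.
exists _, (borelRn R d * T)%type, (sigma \x^ P)%E, U', E'; split => //.
- move=> i j; rewrite (_ : (fun p => _) = fun p =>
    match fintype.split (i : 'I_(1 + k)) with
    | inl a => normalized (v p) a j
    | inr b => U p.2 b j
    end).
    case: (fintype.split _) => a //; under eq_fun do rewrite mxE.
    apply: measurable_funM => //.
    exact: measurableT_comp (measurable_powR _) mvv.
  by apply/funext => p; rewrite [LHS]mxE.
(* If [E'] were null, almost all of its sections would be null, and by [sE'] the event [E] would be
   null. *)
- rewrite lt_neqAle measure_ge0 andbT eq_sym; apply/negP => /eqP.
  rewrite [LHS](_ : _ = \int[P]_t `|sigma (ysection E' t)|)%E; last first.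
    by apply: eq_integral => t _; rewrite gee0_abs.
  move/(ae_eq_integral_abs _ measurableT (measurable_fun_ysection _ mE')).
  move=> [N [mN N0 sN]]; move: PE; rewrite ltNge => /negP; apply.
  rewrite -N0; apply: le_measure; rewrite ?inE// => t Et; apply: sN => /= h.
  by have := sE' _ Et; rewrite h// ltxx.
- move=> [x t] [/= Et v0].
  change (col_mx (normalized (v (x, t))) (U t) *m
    (col_mx (normalized (v (x, t))) (U t))^T = 1%:M :> 'M[R]_(1 + k)).
  rewrite tr_col_mx mul_col_row normalized_unit//.
  have vU : normalized (v (x, t)) *m (U t)^T = 0.
    by rewrite /normalized -scalemxAl gram_schmidt_orth ?scaler0// UE.
  rewrite vU UE// -[U t *m _]trmxK trmx_mul trmxK vU trmx0.
  by rewrite -scalar_mx_block.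
- move=> g rg; have [f [mf Pf fE Uf]] := inv g rg.
  have gsg p : v (p.1 *m g, f p.2) = v p *m g.
    by rewrite /v/= Uf gram_schmidt_rotation.
  (* The fresh point is rotated by [g] itself, and the old parameter moves by [f]. *)
  exists (fun p => (p.1 *m g : borelRn R d, f p.2)); split.
  + apply: measurable_fun_pair.
      exact: measurableT_comp (measurable_mulmxr g) measurable_fst.
    exact: measurableT_comp mf measurable_snd.
  + apply: (preserving_product (f1 := fun x : borelRn R d => x *m g)) => //.
      exact: measurable_mulmxr.
    by move=> B mB; exact: (hsigma.2 g).
  + have vg p : (v p *m g == 0) = (v p == 0).
      apply/eqP/eqP => [h|->]; last by rewrite mul0mx.
      by rewrite -[v p]mulmx1 -rg.1 mulmxA h mul0mx.
    apply/seteqP; split => p; rewrite /E'/= gsg vg -[E (f _)]/((f @^-1` E) _) fE//.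
  + move=> p; rewrite /U' gsg/= Uf normalized_rotation//.
    exact/esym/(mul_col_mx (normalized (v p)) (U p.2) g).
Qed.

(* The determinant of an orthonormal frame may be [-1]; multiplying one row by
   it yields a rotation and preserves equivariance. *)
Lemma random_rotation :
  exists (dT : measure_display) (T : measurableType dT) (P : probability T R)
    (K : T -> 'M[R]_d) (E : set T),
    [/\ forall i j, measurable_fun [set: T] (fun t => K t i j),
        measurable E, (0 < P E)%E, forall t, E t -> rotation (K t) &
        forall g, rotation g -> exists f : T -> T,
          [/\ measurable_fun [set: T] f,
              forall B, measurable B -> P (f @^-1` B) = P B,
              f @^-1` E = E & forall t, K (f t) = K t *m g]].
Proof.
have [dT [T [P [U [E [mU mE PE UE inv]]]]]] := random_frame (leqnn d).
pose i0 : 'I_d := Ordinal (ltnW d1).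
pose D t : 'rV[R]_d := \row_i (if i == i0 then \det (U t) else 1).
have detD t : \det (diag_mx (D t)) = \det (U t).
  rewrite det_diag (bigD1 i0)//= mxE eqxx big1 ?mulr1// => i /negPf i0F.
  by rewrite mxE i0F.
exists dT, T, P, (fun t => diag_mx (D t) *m U t), E; split => //.
- have mdet : measurable_fun [set: T] (fun t => \det (U t)).
    apply: measurable_sum => s; apply: measurable_funM => //.
    by apply: measurable_prod => i _; exact: mU.
  move=> i j; apply: measurable_mulmx => // a b.
  rewrite (_ : (fun t => _) = fun t =>
     (if a == i0 then \det (U t) else 1) *+ (a == b)); last first.
    by apply/funext => t; rewrite !mxE.
  by case: (a == i0); case: (a == b).
- move=> t /UE UU.
  have dd : \det (U t) * \det (U t) = 1.
    by rewrite -{2}(det_tr (U t)) -det_mulmx UU det1.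
  split; last by rewrite det_mulmx detD.
  rewrite trmx_mul mulmxA -(mulmxA _ (U t)) UU mulmx1 tr_diag_mx mulmx_diag.
  apply/matrixP => i j; rewrite !mxE.
  by case: (i == i0) => /=; rewrite ?dd ?mulr1.
- move=> g rg; have [f [mf Pf fE Uf]] := inv g rg.
  by exists f; split => // t; rewrite Uf mulmxA /D Uf det_mulmx rg.2 mulr1.
Qed.

End RandomFrame.

(** * The averaging argument *)

Section UniformPoint.
Context {R : realType} {d : nat} (sigma : probability (borelRn R d) R).
Context (d1 : (1 < d)%N) (hsigma : uniform_on_sphere sigma).
Context {dT : measure_display} {T : measurableType dT} (P : probability T R).
Context (K : T -> 'M[R]_d) (E : set T).
Context (mK : forall i j, measurable_fun [set: T] (fun t => K t i j))
  (mE : measurable E) (KE : forall t, E t -> rotation (K t))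
  (inv : forall g, rotation g -> exists f : T -> T,
    [/\ measurable_fun [set: T] f,
        forall B, measurable B -> P (f @^-1` B) = P B,
        f @^-1` E = E & forall t, K (f t) = K t *m g]).

(** The transpose turns right multiplication of [K t] by [g] into a rotation of the point: [x *m (K
    t *m g)^T = (x *m g^T) *m (K t)^T]. *)
Definition hit (B : set (borelRn R d)) : set (borelRn R d * T) :=
  [set p | E p.2 /\ B (p.1 *m (K p.2)^T)].

Lemma measurable_hit B : measurable B -> measurable (hit B).
Proof.
move=> mB; rewrite (_ : hit B = (@snd (borelRn R d) T) @^-1` E `&`
  (fun p : borelRn R d * T => p.1 *m (K p.2)^T : borelRn R d) @^-1` B)//.
apply: measurableI.
  by rewrite -[X in measurable X]setTI; exact: measurable_snd.
rewrite -[X in measurable X]setTI; apply: measurable_rV => // j.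
apply: measurable_mulmx => [a b|a b].
  rewrite (ord1 a); apply: (measurableT_comp (measurable_coord b)).
  exact: measurable_fst.
rewrite (_ : (fun p => _) = fun p : borelRn R d * T => K p.2 b a); last first.
  by apply/funext => p; rewrite mxE.
exact: measurableT_comp (mK b a) measurable_snd.
Qed.

Lemma hit_const B (x y : 'rV[R]_d) : measurable B -> unit_sphere x ->
  unit_sphere y -> P (xsection (hit B) x) = P (xsection (hit B) y).
Proof.
move=> mB ux uy; have [g rg yE] := rotation_transitive d1 uy ux.
have [f [mf Pf fE Kf]] := inv (rotationT rg).
rewrite -[RHS]Pf; last by apply: measurable_xsection; exact: measurable_hit.
congr (P _); apply/seteqP; split => t; rewrite /xsection/= !inE /hit/=.
  by rewrite -[E (f t)]/((f @^-1` E) t) fE Kf trmx_mul trmxK mulmxA yE.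
by rewrite -[E (f t)]/((f @^-1` E) t) fE Kf trmx_mul trmxK mulmxA yE.
Qed.

(* The law of [x *m (K t)^T] on the event [E] does not depend on the unit
   vector [x], hence can be computed by averaging over [x]. *)
Lemma prob_hit B (x : 'rV[R]_d) : measurable B -> unit_sphere x ->
  P (xsection (hit B) x) = (sigma B * P E)%E.
Proof.
move=> mB ux; have mH := measurable_hit mB.
have mS := @measurable_unit_sphere R d.
have -> : P (xsection (hit B) x) = (sigma \x P)%E (hit B).
  (* By [hit_const] this constant equals [P (xsection (hit B) y)] for [y] on the sphere, that is,
     for almost every [y]. *)
  transitivity (\int[sigma]_y P (xsection (hit B) x))%E.
    by rewrite integral_cst// [X in (_ * X)%E]probability_setT mule1.
  apply: ge0_ae_eq_integral => //; first exact: measurable_fun_xsection.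
  exists (~` (@unit_sphere R d : set (borelRn R d))); split.
  - exact: measurableC.
  - by rewrite [LHS]probability_setC// hsigma.1 subee.
  - by apply: subsetC => y uy _ /=; exact: hit_const.
(* With the integration over the point done first: for fixed [t] in [E], [(K t)^T] is a rotation, so
   the section has measure [sigma B]. *)
rewrite (@product_measure_unique _ _ _ _ _ _ _ (sigma \x^ P)%E)//; last first.
  by move=> *; exact: product_measure2E.
transitivity (\int[P]_(t in E) sigma B)%E; last by rewrite integral_cst.
rewrite integral_mkcond; apply: eq_integral => t _ /=; rewrite patchE.
have [Et|Et] := pselect (E t); last first.
  rewrite memNset//.
  rewrite (_ : ysection _ _ = set0) ?measure0//.
  by apply/seteqP; split => y //; rewrite /ysection/= inE => -[].
rewrite mem_set// -[RHS](hsigma.2 _ _ (rotationT (KE Et)))//; congr (sigma _).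
apply/seteqP; split => y; rewrite /ysection/= inE /hit/=; first by case.
by split.
Qed.

End UniformPoint.

Lemma borel_zero_sum_free (R : realType) d (sigma : probability (borelRn R d) R)
    (B : set (borelRn R d)) : (1 < d)%N -> uniform_on_sphere sigma ->
  measurable B -> zero_sum_free B ->
  (sigma B <= (((d + 1) ^ 2 %/ 2)%N%:R / (d * (d + 1))%N%:R)%:E)%E.
Proof.
move=> d1 hsigma mB B0.
have [dT [T [P [K [E [mK mE PE KE inv]]]]]] := random_rotation d1 hsigma.
have [r [r1 r0]] := simplex_edges R (ltnW d1).
pose F i j := xsection (hit K E B) (r i j).
have mF i j : measurable (F i j).
  by apply: measurable_xsection; exact: measurable_hit.
pose M := ((d + 1) ^ 2 %/ 2)%N.
have FE i j t : F i j t <-> E t /\ B (r i j *m (K t)^T).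
  by rewrite /F /xsection /hit/= inE.
have count t : (\sum_i \sum_(j | i != j) \1_(F i j) t <= M%:R * \1_E t :> R).
  have [Et|nEt] := pselect (E t); last first.
    rewrite [in leRHS]indicE memNset// mulr0 big1// => i _; rewrite big1// => j _.
    by rewrite indicE memNset// => /FE[].
  rewrite [in leRHS]indicE mem_set// mulr1.
  have := zero_sum_free_edges (K t)^T B0 r0.
  (* The floor enters here: the number of arcs is an integer. *)
  rewrite [X in (X <= _)%N]mulnC -leq_divRL// => h.
  apply: (@le_trans _ _
      (\sum_i \sum_j (i != j) && `[< B (r i j *m (K t)^T) >])%N%:R); last first.
    by rewrite ler_nat /M addn1.
  rewrite natr_sum; apply: ler_sum => i _; rewrite natr_sum big_mkcond/=.
  apply: ler_sum => j _; case: (i != j) => //=; rewrite indicE ler_nat.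
  case: asboolP => [_|nB]; first exact: leq_b1.
  by rewrite memNset// => /FE[].
(* Listing the ordered pairs makes the double sum a single one, which is then exchanged with the
   integral of [count]. *)
pose s := [seq p : 'I_d.+1 * 'I_d.+1 <- index_enum _ | p.1 != p.2].
have sumE (V : nmodType) (G : 'I_d.+1 -> 'I_d.+1 -> V) :
    \sum_(p <- s) G p.1 p.2 = \sum_i \sum_(j | i != j) G i j.
  by rewrite big_filter pair_big_dep.
have le_M : (\sum_(p <- s) P (F p.1 p.2) <= M%:R%:E * P E)%E.
  under eq_bigr => p _ do rewrite -[F _ _]setIT -integral_indic//.
  rewrite -ge0_integral_sum//; last first.
    by move=> p; apply/measurable_EFinP; exact: measurable_indic.
  rewrite -[E in leRHS]setIT -integral_indic// -ge0_integralZl//; last first.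
    by apply/measurable_EFinP; exact: measurable_indic.
  apply: ge0_le_integral => //.
  - by move=> t _; apply: sume_ge0 => p _; rewrite lee_fin.
  - apply: emeasurable_sum => p; apply/measurable_EFinP; exact: measurable_indic.
  - apply: measurable_funeM; apply/measurable_EFinP; exact: measurable_indic.
  - move=> t _; rewrite sumEFin -EFinM lee_fin.
    by rewrite (sumE _ (fun i j => \1_(F i j) t)).
have sB : sigma B = (fine (sigma B))%:E by rewrite fineK// fin_num_measure.
have sP : P E = (fine (P E))%:E by rewrite fineK// fin_num_measure.
move: le_M PE; rewrite big_filter_cond.
rewrite [X in (X <= _)%E](eq_bigr (fun=> sigma B * P E)%E); last first.
  move=> p; rewrite andbT => ij.
  by rewrite (prob_hit d1 hsigma mK mE KE inv mB (r1 _ _ ij)).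
rewrite -big_filter_cond.
rewrite sB sP; set a := fine _; set e := fine _; rewrite lte_fin => le_M e0.
(* There are [d (d + 1)] ordered pairs of distinct vertices, each contributing [a * e]; the factor
   [e > 0] then cancels. *)
have {le_M} : (d * (d + 1))%N%:R * (a * e) <= M%:R * e.
  move: le_M; rewrite -EFinM sumEFin lee_fin.
  rewrite (sumE _ (fun _ _ => a * e)).
  under eq_bigr => i _.
    rewrite (eq_bigl (mem (predC1 i))); last by move=> j; rewrite inE eq_sym.
    rewrite sumr_const cardC1 card_ord/=; over.
  by rewrite /= sumr_const card_ord -mulrnA (mulr_natl (a * e)) addn1.
rewrite mulrA ler_pM2r// mulrC => h.
by rewrite lee_fin ler_pdivlMr// ltr0n muln_gt0 addn1 (ltnW d1).
Qed.

(** * From Borel sets to the completion *)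

(** Borel subsets of [A] inherit zero-sum-freeness, so they have measure at most [c]. A countable
    Borel cover of the complement of [A] leaves out such a subset, so this complement has outer
    measure at least [1 - c]. *)
Theorem theorem1p1 (R : realType) (d : nat) (hd : (2 <= d)%N)
    (sigma : probability (borelRn R d) R) (hsigma : uniform_on_sphere sigma)
    (A : set 'rV[R]_d) (hAS : A `<=` @unit_sphere R d)
    (hA : completed_measurable sigma A) (hA0 : zero_sum_free A) :
  (completed sigma A <=
     ((((d + 1) ^ 2) %/ 2)%N%:R / (d * (d + 1))%N%:R)%:E)%E.
Proof.
set c : R := _ / _.
have inner (B : set (borelRn R d)) :
    measurable B -> B `<=` A -> (sigma B <= c%:E)%E.
  move=> mB BA; apply: borel_zero_sum_free => // -[x [y [z [Bx By Bz xyz]]]].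
  by apply: hA0; exists x, y, z; split => //; exact: BA.
have outer : (1 - c%:E <= (sigma^*)%mu (~` A))%E.
  apply/le_ereal_inf_tmp => _ [F [mF AF] <-].
  have mU : measurable (\bigcup_k F k : set (borelRn R d)).
    exact: bigcupT_measurable.
  apply: (@le_trans _ _ (sigma (\bigcup_k F k))).
    rewrite -[\bigcup_k _]setCK probability_setC; last exact: measurableC.
    apply: leeB => //; apply: inner; first exact: measurableC.
    by rewrite -[A]setCK; exact: subsetC.
  exact: measure_sigma_subadditive.
(* The Caratheodory criterion for [A], tested on the whole space. *)
have tot : (1 = completed sigma A + (sigma^*)%mu (~` A))%E.
  rewrite -(probability_setT sigma) -measurable_mu_extE//.
  by rewrite -[~` A]setTI -{1}[A]setTI; exact: hA.
have o0 X : (0 <= (sigma^*)%mu X)%E by exact: mu_ext_ge0.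
have A1 : (completed sigma A <= 1)%E by rewrite tot leeDl.
have C1 : ((sigma^*)%mu (~` A) <= 1)%E by rewrite tot leeDr.
have Af : completed sigma A \is a fin_num.
  by rewrite ge0_fin_numE ?(le_lt_trans A1) ?ltry.
have Cf : (sigma^*)%mu (~` A) \is a fin_num.
  by rewrite ge0_fin_numE ?(le_lt_trans C1) ?ltry.
move: tot outer; rewrite -(fineK Af) -(fineK Cf) -EFinD -EFinB !lee_fin => -[].
by lra.
Qed.
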